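(* Let $\mathbf{u}$ be a smooth divergence-free field on $\mathbb{T}^3=(\mathbb{R}/2\pi\mathbb{Z})^3$ with vorticity $\omega=\nabla\times\mathbf{u}$, and let $S=\tfrac12(\nabla\mathbf{u}+(\nabla\mathbf{u})^{\mathsf T})$ be the strain-rate tensor, with eigenvalues $\lambda_1\ge\lambda_2\ge\lambda_3$ and orthonormal eigenframe $\{f_1,f_2,f_3\}$. Then \[ \langle(\omega\cdot\nabla)\mathbf{u},\omega\rangle_{L^2}=\int_{\mathbb{T}^3}\omega^{\mathsf T}S\,\omega\,\mathrm{d}x=\int_{\mathbb{T}^3}\sum_{i=1}^3\lambda_i\,(\omega\cdot f_i)^2\,\mathrm{d}x . \] Since $\operatorname{Tr}S=\nabla\cdot\mathbf{u}=0$ one has $\lambda_1+\lambda_2+\lambda_3=0$, hence $\lambda_1\ge0\ge\lambda_3$, and the integrand is sign-indefinite: it is positive where $\omega$ aligns with $f_1$ and negative where $\omega$ aligns with $f_3$, unless $S\equiv0$.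
   Context: $((\omega\cdot\nabla)\mathbf{u})_i=\sum_k\omega_k\partial_k u_i$, and $\langle\cdot,\cdot\rangle_{L^2}$ is the inner product of $L^2(\mathbb{T}^3;\mathbb{R}^3)$. The eigenvalues $\lambda_i$ and eigenvectors $f_i$ of $S$ are taken pointwise in $x$, with $f_i$ belonging to $\lambda_i$.
   Formalization: ''Unless S≡0'' is read pointwise: sign claims are made at points x with S(x)≠0, since at a zero of S the integrand vanishes even if S is not identically 0; ''sign-indefinite'' means that the quadratic form of S(x) takes both signs. *)

(* Defs.v *)
From HB Require Import structures.
From mathcomp Require Import all_boot all_order all_algebra.
From mathcomp Require Import all_classical all_reals all_analysis.

Set Implicit Arguments.
Unset Strict Implicit.
Unset Printing Implicit Defensive.

Import Order.TTheory GRing.Theory Num.Theory.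
Import numFieldNormedType.Exports.

Local Open Scope classical_set_scope.
Local Open Scope ring_scope.

Section LinearAlgebra.
Context {R : realType}.
Implicit Types (v w : 'cV[R]_3) (A : 'M[R]_3).

Definition dot v w : R := \sum_i v i 0 * w i 0.

Definition quad A v : R := (v^T *m A *m v) 0 0.

(* Orthonormality of the f i makes the l i the eigenvalues of A counted with
   multiplicity. *)
Definition ordered_eigenframe A (l : 'I_3 -> R) (f : 'I_3 -> 'cV[R]_3) : Prop :=
  [/\ forall i, A *m f i = l i *: f i,
      forall i j, dot (f i) (f j) = (i == j)%:R,
      l 1 <= l 0 & l 2 <= l 1].

Definition frame_form (l : 'I_3 -> R) (f : 'I_3 -> 'cV[R]_3) v : R :=
  \sum_i l i * dot v (f i) ^+ 2.

Definition sign_indefinite (q : 'cV[R]_3 -> R) : Prop :=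
  (exists v, 0 < q v) /\ (exists v, q v < 0).

(* Same line, either orientation; the zero vector is aligned with no unit
   vector. *)
Definition aligned v w : Prop := exists2 c : R, c != 0 & v = c *: w.

End LinearAlgebra.

Section TorusCalculus.
Context {R : realType}.
Implicit Types (g : 'cV[R]_3 -> R) (u v w : 'cV[R]_3 -> 'cV[R]_3).

(* A function on the torus (R / 2 pi Z)^3 is a function on R^3 that is
   2 pi-periodic in each coordinate. *)
Definition torus_periodic (T : Type) (h : 'cV[R]_3 -> T) : Prop :=
  forall (k : 'I_3) x, h (x + (2 * pi) *: delta_mx k 0) = h x.

Definition partial (k : 'I_3) g : 'cV[R]_3 -> R :=
  fun x => 'D_(delta_mx k 0) g x.

Definition iter_partial (s : seq 'I_3) g : 'cV[R]_3 -> R := foldr partial g s.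

Definition smooth g : Prop := forall s : seq 'I_3,
  continuous (iter_partial s g) /\
  forall k x, derivable (iter_partial s g) x (delta_mx k 0).

Definition component u (i : 'I_3) : 'cV[R]_3 -> R := fun x => u x i 0.

Definition smooth_field u : Prop := forall i, smooth (component u i).

Definition divergence u x : R := \sum_i partial i (component u i) x.

(* Indices are taken in 'I_3 = Z/3: the 0-th entry is d_1 u_2 - d_2 u_1, and
   the others follow cyclically. *)
Definition curl u x : 'cV[R]_3 :=
  \col_i (partial (i + 1) (component u (i + 2)) x
          - partial (i + 2) (component u (i + 1)) x).

Definition grad u x : 'M[R]_3 := \matrix_(i, j) partial j (component u i) x.

Definition strain u x : 'M[R]_3 := 2^-1 *: (grad u x + (grad u x)^T).

Definition advect w u x : 'cV[R]_3 :=
  \col_i \sum_k w x k 0 * partial k (component u i) x.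

(* The measure on R^3 lives on the triple product R * R * R, since 'cV[R]_3 has
   no measurable structure. *)
Definition point_of (p : R * R * R) : 'cV[R]_3 :=
  \col_i [:: p.1.1; p.1.2; p.2]`_i.

Definition torus_integral g : R :=
  \int[((@lebesgue_measure R \x @lebesgue_measure R) \x @lebesgue_measure R)%E]_(p
    in `[0, 2 * pi] `*` `[0, 2 * pi] `*` `[0, 2 * pi]) g (point_of p).

Definition L2_inner v w : R := torus_integral (fun x => dot (v x) (w x)).

End TorusCalculus.

(* Main.v *)
Require Import Defs.
From mathcomp Require Import all_boot all_order all_algebra.
From mathcomp Require Import all_classical all_reals all_analysis.
From mathcomp Require Import lra.
Import Order.TTheory GRing.Theory Num.Theory.
Import numFieldNormedType.Exports.
Local Open Scope ring_scope.

(** Both integral identities hold pointwise. The advection term is the quadratic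
    form of [grad u] at [omega], and a quadratic form sees only the symmetric
    part of its matrix. The spectral decomposition [S = F *m diag l *m F^T]
    gives the eigenframe expansion and the trace; as [S] is traceless, it also
    gives [S = 0] as soon as [l 0 <= 0] or [0 <= l 2]. *)

Lemma sum3E (V : nmodType) (F : 'I_3 -> V) : \sum_i F i = F 0 + F 1 + F 2.
Proof.
rewrite !big_ord_recl big_ord0 addr0 addrA.
(* The indices left by [big_ord_recl] are iterated lifts; they match the numerals of ['I_3] through
   their values. *)
by congr (F _ + F _ + F _); apply/val_inj.
Qed.

Section Eigenframe.
Context {R : realType}.
Implicit Types (v w : 'cV[R]_3) (A : 'M[R]_3).
Implicit Types (l : 'I_3 -> R) (f : 'I_3 -> 'cV[R]_3).

Lemma dotE v w : dot v w = (v^T *m w) 0 0.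
Proof. by rewrite mxE; apply: eq_bigr => i _; rewrite mxE. Qed.

Lemma dotZl (c : R) v w : dot (c *: v) w = c * dot v w.
Proof. by rewrite !dotE linearZ -scalemxAl mxE. Qed.

Lemma quadE A v : quad A v = dot v (A *m v).
Proof. by rewrite dotE mulmxA. Qed.

Lemma quad_trmx A v : quad A^T v = quad A v.
Proof.
(* A one-by-one matrix equals its transpose. *)
have -> : quad A v = (v^T *m A *m v)^T 0 0 by rewrite mxE.
by rewrite !trmx_mul trmxK mulmxA.
Qed.

Lemma quad_sym_part A v : quad (2^-1 *: (A + A^T)) v = quad A v.
Proof.
have -> : quad (2^-1 *: (A + A^T)) v = 2^-1 * (quad A v + quad A^T v).
  by rewrite /quad -scalemxAr -scalemxAl mulmxDr mulmxDl !mxE.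
by rewrite quad_trmx; lra.
Qed.

Definition frame_mx f : 'M[R]_3 := \matrix_(i, j) f j i 0.

Section Fixed.
Context {A l f} (Alf : ordered_eigenframe A l f).

(** Orthonormality of the columns is the product in the other order; for square matrices a one-sided
    inverse is two-sided. *)
Lemma frame_mx_orthogonal : frame_mx f *m (frame_mx f)^T = 1%:M.
Proof.
apply: mulmx1C; apply/matrixP => i j; case: Alf => _ orth _ _.
by rewrite !mxE -orth; apply: eq_bigr => k _; rewrite !mxE.
Qed.

Lemma eigenframe_spectral :
  A = frame_mx f *m diag_mx (\row_i l i) *m (frame_mx f)^T.
Proof.
(* Cancelling [F^T] leaves [A *m F = F *m diag l], whose columns are the eigenvector equations. *)
rewrite -[LHS]mulmx1 -frame_mx_orthogonal mulmxA; congr (_ *m _).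
apply/matrixP => i j; rewrite mul_mx_diag !mxE.
case: Alf => /(_ j) /colP /(_ i); rewrite !mxE mulrC => <- _ _ _.
by apply: eq_bigr => k _; rewrite !mxE.
Qed.

Lemma eigenframe_quad v : quad A v = frame_form l f v.
Proof.
(* These are the coordinates of [v] in the frame, where the form is diagonal. *)
have Fv : (frame_mx f)^T *m v = \col_i dot v (f i).
  apply/colP => i; rewrite !mxE.
  by apply: eq_bigr => k _; rewrite !mxE mulrC.
have -> : quad A v = (((frame_mx f)^T *m v)^T *m diag_mx (\row_i l i)
                      *m ((frame_mx f)^T *m v)) 0 0.
  by rewrite /quad [in LHS]eigenframe_spectral trmx_mul trmxK !mulmxA.
rewrite Fv mul_mx_diag mxE; apply: eq_bigr => i _.
by rewrite !mxE mulrAC mulrC.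
Qed.

Lemma eigenframe_trace : \tr A = l 0 + l 1 + l 2.
Proof.
(* Cyclicity of the trace brings [F^T] next to [F]. *)
rewrite eigenframe_spectral mxtrace_mulC mulmxA.
rewrite (mulmx1C frame_mx_orthogonal) mul1mx mxtrace_diag sum3E.
by rewrite !mxE.
Qed.

(** By orthonormality only the [i]-th term survives, so on each eigenline the sign of the form is
    that of the eigenvalue, whichever the orientation. *)
Lemma eigenframe_form (c : R) i : frame_form l f (c *: f i) = l i * c ^+ 2.
Proof.
case: Alf => _ orth _ _; rewrite /frame_form (bigD1 i) //= big1 => [|j ji].
  by rewrite dotZl orth eqxx mulr1 addr0.
by rewrite dotZl orth eq_sym (negbTE ji) mulr0 expr0n mulr0.
Qed.

Lemma eigenframe_eq0 : (forall i, l i = 0) -> A = 0.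
Proof.
move=> l0; rewrite eigenframe_spectral.
have -> : \row_i l i = 0 by apply/rowP => i; rewrite !mxE.
by rewrite linear0 mulmx0 mul0mx.
Qed.

Lemma traceless_eigenvalue_bounds : \tr A = 0 -> l 2 <= 0 <= l 0.
Proof.
by rewrite eigenframe_trace => tr0; case: Alf => _ _ l10 l21; apply/andP; lra.
Qed.

Lemma traceless_eigenvalue_signs : \tr A = 0 -> A != 0 -> l 2 < 0 < l 0.
Proof.
move=> tr0 A0; have /andP[l2 l0] := traceless_eigenvalue_bounds tr0.
move: tr0; rewrite eigenframe_trace => tr0; case: Alf => _ _ l10 l21.
have l_neq0 : ~ [/\ l 0 = 0, l 1 = 0 & l 2 = 0].
  move=> [z0 z1 z2]; move/eqP: A0; apply; apply: eigenframe_eq0 => i.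
  case: i => [[|[|[|//]]] ip].
  - by rewrite -z0; congr l; apply/val_inj.
  - by rewrite -z1; congr l; apply/val_inj.
  - by rewrite -z2; congr l; apply/val_inj.
(* If either strict inequality fails, all three eigenvalues have one weak sign; summing to zero,
   they vanish. *)
by apply/andP; split; rewrite ltNge; apply/negP => h; apply: l_neq0; split; lra.
Qed.

Lemma frame_form_gt0 v : 0 < l 0 -> aligned v (f 0) -> 0 < frame_form l f v.
Proof.
by move=> l0 [c c0 ->]; rewrite eigenframe_form mulr_gt0// exprn_even_gt0.
Qed.

Lemma frame_form_lt0 v : l 2 < 0 -> aligned v (f 2) -> frame_form l f v < 0.
Proof.
by move=> l2 [c c0 ->]; rewrite eigenframe_form nmulr_rlt0// exprn_even_gt0.
Qed.

End Fixed.
End Eigenframe.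

Section Fields.
Context {R : realType}.
Implicit Types u w : 'cV[R]_3 -> 'cV[R]_3.

Lemma advectE w u x : advect w u x = grad u x *m w x.
Proof.
by apply/colP => i; rewrite !mxE; apply: eq_bigr => k _; rewrite mxE mulrC.
Qed.

Lemma dot_advect w u x : dot (advect w u x) (w x) = quad (strain u x) (w x).
Proof.
rewrite quad_sym_part quadE advectE.
by apply: eq_bigr => i _; rewrite mulrC.
Qed.

(** Transposition preserves the trace, so symmetrizing the gradient does not change it. *)
Lemma mxtrace_strain u x : \tr (strain u x) = divergence u x.
Proof.
have -> : divergence u x = \tr (grad u x).
  by apply: eq_bigr => i _; rewrite mxE.
by rewrite mxtraceZ mxtraceD mxtrace_tr; lra.
Qed.

End Fields.

Theorem proposition3p1 (R : realType) (u : 'cV[R]_3 -> 'cV[R]_3)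
    (lambda : 'I_3 -> 'cV[R]_3 -> R) (f : 'I_3 -> 'cV[R]_3 -> 'cV[R]_3)
    (u_periodic : torus_periodic u) (u_smooth : smooth_field u)
    (u_divfree : forall x, divergence u x = 0)
    (lambda_periodic : forall i, torus_periodic (lambda i))
    (f_periodic : forall i, torus_periodic (f i))
    (eigen : forall x,
       ordered_eigenframe (strain u x) (fun i => lambda i x) (fun i => f i x)) :
  let omega := curl u in
  let S := strain u in
  let q x := frame_form (fun i => lambda i x) (fun i => f i x) in
  [/\ L2_inner (advect omega u) omega
        = torus_integral (fun x => quad (S x) (omega x)),
      torus_integral (fun x => quad (S x) (omega x))
        = torus_integral (fun x => q x (omega x)),
      forall x, \tr (S x) = divergence u x /\ \tr (S x) = 0,
      forall x, lambda 0 x + lambda 1 x + lambda 2 x = 0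
                /\ lambda 2 x <= 0 <= lambda 0 x
    & forall x, S x != 0 ->
        [/\ sign_indefinite (q x),
            aligned (omega x) (f 0 x) -> 0 < q x (omega x)
          & aligned (omega x) (f 2 x) -> q x (omega x) < 0]].
Proof.
move=> omega S q.
have trS x : \tr (S x) = 0 by rewrite mxtrace_strain.
split.
(* The integrands are equal as functions, so no integrability question arises. *)
- by congr torus_integral; apply/funext => x; rewrite dot_advect.
- congr torus_integral; apply/funext => x.
  exact: (eigenframe_quad (eigen x)).
- by move=> x; rewrite mxtrace_strain.
- move=> x; split; last exact: (traceless_eigenvalue_bounds (eigen x)).
  by rewrite -[LHS](eigenframe_trace (eigen x)).
move=> x Sx0.
have /andP[l2 l0] := traceless_eigenvalue_signs (eigen x) (trS x) Sx0.
(* This lets [f 0 x] and [f 2 x] themselves serve as the witnesses of the two signs. *)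
have self_aligned (v : 'cV[R]_3) : aligned v v.
  by exists 1; rewrite ?oner_neq0 ?scale1r.
split; [split| |].
- by exists (f 0 x); apply: (frame_form_gt0 (eigen x)).
- by exists (f 2 x); apply: (frame_form_lt0 (eigen x)).
- exact: (frame_form_gt0 (eigen x)).
- exact: (frame_form_lt0 (eigen x)).
Qed.
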